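(* Let $r \ge 2$ be a fixed integer and let $\mathcal{H}$ be an $r$-uniform, $D$-regular hypergraph on $N$ vertices, where $D = D(N) \to \infty$ as $N \to \infty$. If the maximum degree $L = L(N)$ of a pair of distinct vertices in $\mathcal{H}$ satisfies $L = D/(\log N)^{\omega(1)}$, and $X(\mathcal{H})$ is the proportion of vertices of $\mathcal{H}$ that are not saturated by the matching produced by the random greedy matching algorithm on $\mathcal{H}$, then with high probability \[ X(\mathcal{H}) \le \left( \frac{L}{D} \right)^{\frac{1}{2(r-1)} + o(1)}. \]
   Context: A hypergraph is $r$-uniform if every edge is a set of $r$ vertices, and $D$-regular if every vertex lies in exactly $D$ edges. The degree of a pair $\{u,v\}$ of distinct vertices is the number of edges containing both $u$ and $v$; $L$ is the maximum of these degrees. A matching is a collection of pairwise disjoint edges; a vertex is saturated by a matching if it lies in one of its edges. Random greedy matching algorithm on $\mathcal{H}$ (with vertex set $V$): set $\mathcal{M}(0) = \emptyset$, $\mathcal{H}(0) = \mathcal{H}$, $V(0) = V$. In iteration $i \ge 1$, an edge $E_i$ is chosen uniformly at random from the edges of $\mathcal{H}(i-1)$ and added to $\mathcal{M}(i-1)$ to form the matching $\mathcal{M}(i)$; set $V(i) = V(i-1) \setminus E_i$, and form $\mathcal{H}(i)$ by deleting from $\mathcal{H}(i-1)$ all edges that intersect $E_i$ (including $E_i$ itself). The process terminates at the step $M$ at which $\mathcal{H}(M)$ has no edges. Thus the matching produced is $\mathcal{M}(M)$, it has $M$ edges, and $X(\mathcal{H}) = 1 - Mr/N$. Asymptotics: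 the statement concerns a sequence of hypergraphs $\mathcal{H} = \mathcal{H}_N$ with $N \to \infty$ and $r$ fixed. ''With high probability'' means with probability tending to $1$ as $N \to \infty$. The hypothesis $L = D/(\log N)^{\omega(1)}$ means that there is a function $h(N) \to \infty$ with $L = D/(\log N)^{h(N)}$. The conclusion means that there is a deterministic function $\epsilon(N) \to 0$ such that $X(\mathcal{H}) \le (L/D)^{1/(2(r-1)) + \epsilon(N)}$ with probability tending to $1$ as $N \to \infty$. *)

(* Defs.v *)
From mathcomp Require Import all_boot all_order all_algebra.
From mathcomp Require Import reals.

Set Implicit Arguments.
Unset Strict Implicit.
Unset Printing Implicit Defensive.

Import Order.TTheory GRing.Theory Num.Theory.

Local Open Scope ring_scope.

(* A hypergraph with vertex set V is its set of edges, H : {set {set V}}. *)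
Section Hypergraph.
Variable V : finType.
Implicit Types (H M : {set {set V}}) (E : {set V}).

Definition uniform (r : nat) H : Prop := forall E, E \in H -> #|E| = r.

Definition regular (D : nat) H : Prop :=
  forall v : V, #|[set E in H | v \in E]| = D.

Definition pair_degree H (u v : V) : nat :=
  #|[set E in H | (u \in E) && (v \in E)]|.

Definition max_pair_degree H : nat :=
  \max_(p : V * V | p.1 != p.2) pair_degree H p.1 p.2.

(* The edges of H disjoint from E.  Since E meets itself when it is nonempty,
   E is deleted too. *)
Definition delete_meeting H E : {set {set V}} := [set F in H | [disjoint F & E]].

Variable R : realType.

Definition unsaturated M : R := #|~: cover M|%:R / #|V|%:R.

(* Probability that the random greedy algorithm started from H chooses
   successively the edges of s (in this order) and then terminates. *)
Fixpoint run_prob H (s : seq {set V}) : R :=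
  if s is E :: s' then
    if E \in H then #|H|%:R^-1 * run_prob (delete_meeting H E) s' else 0
  else (H == set0)%:R.

(* Probability of the event A about the matching produced from H.  Each
   iteration removes at least one vertex if the edges are nonempty, so every
   run has at most #|V| steps; see greedy_prT. *)
Definition greedy_pr H (A : pred {set {set V}}) : R :=
  \sum_(s : #|V|.-bseq {set V} | A [set E in s]) run_prob H s.

Lemma run_prob_ge0 H s : 0 <= run_prob H s.
Proof.
elim: s H => [|E s IH] H /=; first exact: ler0n.
by case: ifP => // _; rewrite mulr_ge0 // invr_ge0 ler0n.
Qed.

Lemma sum_run_prob n H :
    (forall E, E \in H -> E != set0) -> (#|cover H| <= n)%N ->
  \sum_(s : n.-bseq {set V}) run_prob H s = 1.
Proof.
elim: n H => [|n IH] H H0 Hn.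
  have -> : H = set0.
    apply/setP => E; rewrite inE; apply/negP => EH.
    have /set0Pn[x xE] := H0 _ EH.
    move: Hn; rewrite leqn0 cards_eq0 => /eqP/setP/(_ x).
    by rewrite inE => /negP[]; apply/bigcupP; exists E.
  rewrite (@big_pred1 _ _ _ _ [bseq]); first by rewrite /= eqxx.
  by move=> s; rewrite /= [s]bseq0 eqxx.
pose f (o : option ({set V} * n.-bseq {set V})) : n.+1.-bseq {set V} :=
  if o is Some p then [bseq of p.1 :: p.2] else [bseq].
have fbij : {on [pred s : n.+1.-bseq {set V} | true], bijective f}.
  exists (fun s => if s : seq _ is E :: s' then Some (E, insub_bseq n s') else None).
    case=> [[E s]|] _ //=; congr (Some (_, _)); apply: val_inj.
    by rewrite /= insubdK // unfold_in size_bseq.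
  case=> [[|E s] ss] _; apply: val_inj => //=; congr cons.
  by rewrite insubdK.
rewrite (reindex f) //= (bigD1 None) //=.
rewrite (reindex_omap Some id) /=; last by case.
rewrite (eq_bigl xpredT); last by move=> x /=; rewrite eqxx.
under eq_bigr do rewrite /=.
rewrite -(pair_bigA _ (fun E (s : n.-bseq _) => if E \in H then
   #|H|%:R^-1 * run_prob (delete_meeting H E) s else 0)) /=.
have inner E : \sum_(s : n.-bseq _) (if E \in H then
   #|H|%:R^-1 * run_prob (delete_meeting H E) s else 0) =
   if E \in H then #|H|%:R^-1 else 0 :> R.
  case: ifP => EH; last by rewrite big1.
  rewrite -mulr_sumr IH ?mulr1 //.
    by move=> F; rewrite inE => /andP[/H0].
  rewrite -ltnS (leq_trans _ Hn) //; apply: proper_card.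
  apply/properP; split.
    apply/bigcupsP => F; rewrite inE => /andP[FH _].
    by apply: bigcup_sup FH.
  have /set0Pn[x xE] := H0 _ EH; exists x.
    by apply/bigcupP; exists E.
  apply/bigcupP => -[F]; rewrite inE => /andP[_ /pred0P/(_ x)] /= + xF.
  by rewrite xE xF.
under eq_bigr do rewrite inner.
rewrite -big_mkcond /= sumr_const -[X in _ + X]mulr_natl.
have [->|HN0] := eqVneq H set0; first by rewrite cards0 mul0r addr0.
by rewrite add0r divff // pnatr_eq0 cards_eq0.
Qed.

Lemma greedy_prT H :
  (forall E, E \in H -> E != set0) -> greedy_pr H xpredT = 1.
Proof. by move=> H0; apply: sum_run_prob => //; apply: max_card. Qed.

End Hypergraph.

Arguments unsaturated {V} R M.
Arguments greedy_pr {V} R H A.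

(* Main.v *)
Require Import Defs.
From mathcomp Require Import all_boot all_order all_algebra.
From mathcomp Require Import reals.
From mathcomp Require Import zify ring lra.
Import Order.TTheory GRing.Theory Num.Theory.

Set Implicit Arguments.
Unset Strict Implicit.
Unset Printing Implicit Defensive.

(* The state of the process is the set U of unsaturated vertices: the remaining
   hypergraph consists of the edges contained in U. Write n = |U|, q for the
   number of remaining edges and d_v for the remaining degrees.

   Choosing E uniformly, d_v decreases in mean by about
   (1/q) * sum_(F containing v) sum_(u in F, u <> v) d_u, so if all degree gaps
   d_v - d_w are at most eps, the gap z = d_v - d_w has drift at most about
   (r(r-1)/n) (eps - z), which vanishes as z reaches eps. The steps of d_v are
   O(L), with total variance O(L D log N), so with lam = (L D)^(-1/2) the
   potential sum_(v, w) exp(lam (d_v - d_w) - g n) is, up to a negligible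
   additive error, a supermartingale for a slowly growing barrier
   g = O(log^2 N). It starts at O(1/N), hence with high probability all gaps
   stay below e = O(log^2 N) sqrt(L D).

   Bounded gaps alone force, deterministically, q >= N D (n/N)^r / r - O(e n),
   so edges remain as long as D (n/N)^(r-1) exceeds sqrt(L D) polylog(N), i.e.
   n/N >= (L/D)^(1/(2(r-1))) (log N)^5. As log N = (D/L)^(1/h), the logarithms
   amount to the exponent eps = -5/h. *)

(** * Double counting *)

Lemma card_set_sum (T : finType) (A : {set T}) (P : pred T) :
  #|[set x in A | P x]| = \sum_(x in A) P x.
Proof.
rewrite -sum1dep_card big_mkcondr /=.
by apply: eq_bigr => x _; case: (P x).
Qed.

Section Degrees.
Variable V : finType.
Implicit Types (G : {set {set V}}) (E F A : {set V}) (u v : V).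

Definition deg G v := #|[set E in G | v \in E]|.

Definition loss G E v := #|[set F in G | (v \in F) && ~~ [disjoint F & E]]|.

Lemma loss_deg G E v : loss G E v + deg (delete_meeting G E) v = deg G v.
Proof.
rewrite /loss /deg -[RHS](cardsID [set F : {set V} | [disjoint F & E]]) addnC.
congr (_ + _); apply: eq_card => F; rewrite !inE;
  by case: (F \in G); case: (v \in F); case: [disjoint F & E].
Qed.

Lemma sum_deg G A : \sum_(u in A) deg G u = \sum_(E in G) #|E :&: A|.
Proof.
under eq_bigr do rewrite /deg card_set_sum.
rewrite exchange_big /=; apply: eq_bigr => E _.
rewrite setIC -card_set_sum; apply: eq_card => x; by rewrite !inE.
Qed.

Lemma meets_le_card E F : ~~ [disjoint F & E] <= #|E :&: F|.
Proof. by rewrite (setIC E) -setI_eq0 -card_gt0; case: #|_|. Qed.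

Lemma loss_le_sum G E v : loss G E v <= \sum_(u in E) pair_degree G v u.
Proof.
under eq_bigr do rewrite /pair_degree card_set_sum.
rewrite exchange_big /= /loss card_set_sum; apply: leq_sum => F _.
case: (v \in F) => //=.
apply: leq_trans (meets_le_card _ _) _.
by rewrite -card_set_sum.
Qed.

(** For [v] in [F], these are the choices that destroy [F] while [v] stays unsaturated. Choices
    through [v] are left out because [v] then leaves the potential. *)
Definition meets_avoiding G v F :=
  #|[set E in G | (v \notin E) && ~~ [disjoint F & E]]|.

(** Both sides count the pairs [(E, F)] with [v] in [F] but not in [E], and with [E] meeting [F]. *)
Lemma sum_loss G v :
  \sum_(E in G | v \notin E) loss G E v =
  \sum_(F in G | v \in F) meets_avoiding G v F.
Proof.
rewrite big_mkcondr [RHS]big_mkcondr /=.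
have EL E : (if v \notin E then loss G E v else 0) =
   \sum_(F in G) [&& v \notin E, v \in F & ~~ [disjoint F & E]].
  case: ifP => _; last by rewrite big1.
  by rewrite /loss card_set_sum.
have ER F : (if v \in F then meets_avoiding G v F else 0) =
   \sum_(E in G) [&& v \notin E, v \in F & ~~ [disjoint F & E]].
  case: ifP => _ /=.
    by rewrite /meets_avoiding card_set_sum; apply: eq_bigr.
  by rewrite big1 // => E _; rewrite andbF.
under eq_bigr do rewrite EL.
under [RHS]eq_bigr do rewrite ER.
exact: exchange_big.
Qed.

(** Union bound: an edge that avoids [v] can meet [F] only in [F :\ v]. *)
Lemma meets_avoiding_le G v F :
  meets_avoiding G v F <= \sum_(u in F :\ v) deg G u.
Proof.
rewrite sum_deg /meets_avoiding card_set_sum; apply: leq_sum => E _.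
case vE : (v \in E) => //=.
rewrite -setI_eq0 -card_gt0.
have -> : E :&: (F :\ v) = F :&: E.
  apply/setP => x; rewrite !inE.
  by case: eqVneq => [->|]; rewrite ?vE ?andbF // andbC.
by case: #|_|.
Qed.

(* Inclusion-exclusion truncated at pairs: if [k = |E ∩ F \ v| > 1], or if
   [k > 0] and [v] is in [E], then [E ∩ F] contains at least [k] ordered pairs
   of distinct vertices. *)
Lemma sum_deg_le_meets_avoiding G v F : v \in F ->
  \sum_(u in F :\ v) deg G u <=
  meets_avoiding G v F +
  \sum_(x in F) \sum_(y in F :\ x) pair_degree G x y.
Proof.
move=> vF.
have -> : \sum_(x in F) \sum_(y in F :\ x) pair_degree G x y =
  \sum_(E in G) \sum_(x in F :&: E) #|E :&: (F :\ x)|.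
  transitivity (\sum_(x in F) \sum_(E in G) (x \in E) * #|E :&: (F :\ x)|).
    apply: eq_bigr => x xF.
    under eq_bigr do rewrite /pair_degree card_set_sum.
    rewrite exchange_big /=; apply: eq_bigr => E _.
    case: (x \in E) => /=; last by rewrite big1.
    rewrite mul1n -card_set_sum; apply: eq_card => y; by rewrite !inE andbC.
  rewrite exchange_big /=; apply: eq_bigr => E _.
  rewrite [RHS](eq_bigl (fun x => (x \in F) && (x \in E))); last by move=> x; rewrite inE.
  rewrite [RHS]big_mkcondr /=; apply: eq_bigr => x _.
  by case: (x \in E); rewrite ?mul1n.
rewrite sum_deg /meets_avoiding card_set_sum -big_split /=.
apply: leq_sum => E _.
have [vE|vE] /= := boolP (v \in E).
  by rewrite (bigD1 v) ?inE ?vF //= leq_addr.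
have -> : E :&: (F :\ v) = F :&: E.
  apply/setP => x; rewrite !inE.
  by case: eqVneq => [->|]; rewrite ?(negbTE vE) ?andbF // andbC.
rewrite -setI_eq0 -card_gt0.
under eq_bigr => x xFE.
  have -> : #|E :&: (F :\ x)| = #|F :&: E|.-1.
    rewrite (cardsD1 x (F :&: E)) xFE /=; apply: eq_card => y.
    by rewrite !inE; case: (y == x); rewrite ?andbF //= andbC.
  over.
rewrite sum_nat_const; case: #|_| => [|[|k]] //=; lia.
Qed.

End Degrees.

(** * Losses and degrees under a bound on pair degrees *)

Section Bounds.
Local Open Scope nat_scope.
Variables (V : finType) (G : {set {set V}}) (r L : nat).
Hypothesis Gr : uniform r G.
Hypothesis GL : forall u v, u != v -> pair_degree G u v <= L.
Implicit Types (E F : {set V}) (u v : V).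

(** Each lost edge contains [v] and one of the [r] vertices of [E], all different from [v]. This
    bounds the jumps of a surviving vertex's degree; for [v] in [E] the loss would be the whole
    degree. *)
Lemma loss_le E v : E \in G -> v \notin E -> loss G E v <= r * L.
Proof.
move=> EG vE; apply: leq_trans (loss_le_sum _ _ _) _.
rewrite -(Gr EG) -sum_nat_const; apply: leq_sum => u uE.
by apply: GL; apply: contraNneq vE => ->.
Qed.

Lemma sum_deg_le v F : F \in G -> v \in F ->
  \sum_(u in F :\ v) deg G u <= meets_avoiding G v F + r ^ 2 * L.
Proof.
move=> FG vF; apply: leq_trans (sum_deg_le_meets_avoiding _ vF) _.
rewrite leq_add2l -mulnn -mulnA -(Gr FG) -sum_nat_const.
apply: leq_sum => x xF.
apply: (@leq_trans (\sum_(y in F :\ x) L)).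
  by apply: leq_sum => y; rewrite !inE => /andP[yx _]; rewrite GL // eq_sym.
by rewrite sum_nat_const leq_mul // subset_leq_card // subD1set.
Qed.

(** Since [r > 1], each edge at [v] has a second vertex. Applied to [H], this gives [D <= N * L],
    which later keeps large sets from having few vertices. *)
Lemma deg_le_mul_pair_degree v : 1 < r -> deg G v <= #|V| * L.
Proof.
move=> r1; apply: (@leq_trans (\sum_(u in [set~ v]) pair_degree G v u)).
  under eq_bigr do rewrite /pair_degree card_set_sum.
  rewrite exchange_big /= /deg card_set_sum; apply: leq_sum => F FG.
  case vF : (v \in F) => //=.
  rewrite -card_set_sum card_gt0.
  have : 0 < #|F :\ v| by have := cardsD1 v F; rewrite vF (Gr FG) => rE; lia.
  rewrite card_gt0 => /set0Pn[x]; rewrite !inE => /andP[xv xF].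
  by apply/set0Pn; exists x; rewrite !inE xv xF.
apply: (@leq_trans (\sum_(u in [set~ v]) L)).
  by apply: leq_sum => y; rewrite !inE => yx; rewrite GL // eq_sym.
by rewrite sum_nat_const leq_mul // max_card.
Qed.

Lemma sum_deg_uniform (U : {set V}) :
  (forall E, E \in G -> E \subset U) -> \sum_(u in U) deg G u = r * #|G|.
Proof.
move=> GU; rewrite sum_deg mulnC -sum_nat_const; apply: eq_bigr => E EG.
by rewrite (setIidPl (GU _ EG)) (Gr EG).
Qed.

Lemma card_delete_meeting_ge E :
  #|G| <= #|delete_meeting G E| + \sum_(u in E) deg G u.
Proof.
rewrite sum_deg /delete_meeting card_set_sum -big_split /= -sum1_card.
apply: leq_sum => F FG.
by have := meets_le_card E F; case: [disjoint F & E] => /=; rewrite 1?setIC //; case: #|_|.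
Qed.

Local Open Scope ring_scope.
Variables (R : realFieldType) (a b : R).
Hypothesis ab : forall E u, E \in G -> u \in E -> a <= (deg G u)%:R <= b.

Lemma sum_loss_le v :
  \sum_(E in G | v \notin E) (loss G E v)%:R <= (deg G v)%:R * ((r%:R - 1) * b).
Proof.
rewrite -natr_sum sum_loss natr_sum.
have -> : (deg G v)%:R = \sum_(F in G | v \in F) 1%:R :> R.
  by rewrite -natr_sum sum1dep_card.
rewrite mulr_suml; apply: ler_sum => F /andP[FG vF]; rewrite mul1r.
have cF : #|F :\ v|%:R = r%:R - 1 :> R.
  by rewrite -(Gr FG) (cardsD1 v F) vF natrD addrAC subrr add0r.
apply: (@le_trans _ _ (\sum_(u in F :\ v) (deg G u)%:R)).
  by rewrite -natr_sum ler_nat meets_avoiding_le.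
rewrite -cF mulr_natl -sumr_const; apply: ler_sum => u.
by rewrite !inE => /andP[_ uF]; have /andP[] := ab FG uF.
Qed.

Lemma sum_loss_ge v :
  (deg G v)%:R * ((r%:R - 1) * a - r%:R ^+ 2 * L%:R) <=
  \sum_(E in G | v \notin E) (loss G E v)%:R.
Proof.
rewrite -natr_sum sum_loss natr_sum.
have -> : (deg G v)%:R = \sum_(F in G | v \in F) 1%:R :> R.
  by rewrite -natr_sum sum1dep_card.
rewrite mulr_suml; apply: ler_sum => F /andP[FG vF]; rewrite mul1r lerBlDr.
have cF : #|F :\ v|%:R = r%:R - 1 :> R.
  by rewrite -(Gr FG) (cardsD1 v F) vF natrD addrAC subrr add0r.
apply: (@le_trans _ _ (\sum_(u in F :\ v) (deg G u)%:R)).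
  rewrite -cF mulr_natl -sumr_const; apply: ler_sum => u.
  by rewrite !inE => /andP[_ uF]; have /andP[] := ab FG uF.
by rewrite -natr_sum -natrX -natrM -natrD ler_nat sum_deg_le.
Qed.

End Bounds.

(** * Hypergraphs induced on the unsaturated vertices *)

Section Induced.
Variables (V : finType) (H : {set {set V}}).
Implicit Types (U E : {set V}).

Definition edges_within U := [set E in H | E \subset U].

Lemma edges_withinT : edges_within setT = H.
Proof. by apply/setP => E; rewrite inE subsetT andbT. Qed.

Lemma edges_within_sub U : edges_within U \subset H.
Proof. by apply/subsetP => E; rewrite inE => /andP[]. Qed.

Lemma delete_meeting_edges_within U E :
  delete_meeting (edges_within U) E = edges_within (U :\: E).
Proof. by apply/setP => F; rewrite !inE subsetD andbA. Qed.

Lemma uniform_edges_within r U : uniform r H -> uniform r (edges_within U).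
Proof. by move=> Hr E /(subsetP (edges_within_sub U))/Hr. Qed.

Lemma pair_degree_edges_within U u v :
  u != v -> (pair_degree (edges_within U) u v <= max_pair_degree H)%N.
Proof.
move=> uv; apply: (@leq_trans (pair_degree H u v)).
  apply: subset_leq_card; apply/subsetP => E; rewrite !inE.
  by move=> /andP[/andP[-> _] ->].
exact: (@leq_bigmax_cond _ (fun p : V * V => p.1 != p.2)
         (fun p => pair_degree H p.1 p.2) (u, v)).
Qed.

End Induced.

(** * The process as a recursion on the set of unsaturated vertices *)

Section Supermartingale.
Local Open Scope ring_scope.
Variable R : realType.

Lemma big_bseqS (T : finType) (n : nat) (f : seq T -> R) :
  \sum_(s : n.+1.-bseq T) f s =
  f [::] + \sum_(x : T) \sum_(s : n.-bseq T) f (x :: s).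
Proof.
pose g (o : option (T * n.-bseq T)) : n.+1.-bseq T :=
  if o is Some p then [bseq of p.1 :: p.2] else [bseq].
rewrite (reindex g) /=; last first.
  exists (fun s => if s : seq _ is x :: s' then Some (x, insub_bseq n s') else None).
    case=> [[x s]|] _ //=; congr (Some (_, _)); apply: val_inj.
    by rewrite /= insubdK // unfold_in size_bseq.
  by case=> [[|x s] ss] _; apply: val_inj => //=; congr cons; rewrite insubdK.
rewrite (bigD1 None) //=; congr (_ + _).
rewrite pair_big /= (reindex_omap Some id) /=; last by case.
by apply: eq_bigl => x /=; rewrite eqxx.
Qed.

Variables (V : finType) (H : {set {set V}}) (t : R).
Variables (Inv : {set V} -> Prop) (Psi : {set V} -> R).
Hypothesis H0 : forall E, E \in H -> E != set0.
Hypothesis step : forall U, Inv U ->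
  [\/ #|U|%:R <= t /\ 0 <= Psi U, 1 <= Psi U |
     [/\ edges_within H U != set0, forall E, E \in edges_within H U -> Inv (U :\: E) &
      \sum_(E in edges_within H U) Psi (U :\: E) <= #|edges_within H U|%:R * Psi U]].

(** Markov's inequality for a supermartingale stopped once [U] has at most [t] vertices or [Psi]
    reaches 1. There the probability is 0, respectively at most 1; otherwise condition on the first
    edge chosen. The remaining edges ensure that the run does not end at such a [U]. *)
Lemma sum_run_prob_le_potential n (U : {set V}) : (#|U| <= n)%N -> Inv U ->
  \sum_(s : n.-bseq {set V} | t < #|U :\: cover [set E in s]|%:R)
    run_prob R (edges_within H U) s <= Psi U.
Proof.
have H0' (A E : {set V}) : E \in edges_within H A -> E != set0 by rewrite inE => /andP[/H0].
have large (A : {set V}) m : (#|A| <= m)%N -> 1 <= Psi A ->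
    \sum_(s : m.-bseq {set V} | t < #|A :\: cover [set E in s]|%:R)
      run_prob R (edges_within H A) s <= Psi A.
  move=> Am; apply: le_trans.
  rewrite -(@sum_run_prob _ R m (edges_within H A)); last 2 first.
  - exact: H0'.
  - apply: leq_trans Am; apply: subset_leq_card; apply/bigcupsP => E.
    by rewrite inE => /andP[].
  rewrite big_mkcond; apply: ler_sum => s _; case: ifP => // _.
  exact: run_prob_ge0.
have small (A : {set V}) m : #|A|%:R <= t -> 0 <= Psi A ->
    \sum_(s : m.-bseq {set V} | t < #|A :\: cover [set E in s]|%:R)
      run_prob R (edges_within H A) s <= Psi A.
  move=> At PA; rewrite big_pred0 // => s; apply/negbTE; rewrite -leNgt.
  by apply: le_trans At; rewrite ler_nat subset_leq_card // subsetDl.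
elim: n U => [|n IH] U Un /step[[]|Psi1|[HU0 IE sE]]; try exact: small; try exact: large.
- case/negP: HU0; apply/eqP/setP => E; rewrite [RHS]inE; apply/negP => EU.
  have := H0' _ _ EU; move: EU; rewrite inE => /andP[_].
  move: Un; rewrite leqn0 cards_eq0 => /eqP ->.
  by rewrite subset0 => ->.
rewrite big_mkcond (big_bseqS n (fun s => if t < #|U :\: cover [set E in s]|%:R
  then run_prob R (edges_within H U) s else 0)) /= (negbTE HU0) if_same add0r.
have q0 : 0 < #|edges_within H U|%:R :> R by rewrite ltr0n card_gt0.
rewrite -(ler_pM2l q0); apply: le_trans sE.
rewrite mulr_sumr [leRHS]big_mkcond /=; apply: ler_sum => E _.
case: ifP => EU; last by rewrite big1 ?mulr0 // => s _; rewrite if_same.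
have /andP[EH EsU] : (E \in H) && (E \subset U) by move: EU; rewrite inE.
rewrite mulr_sumr; apply: le_trans (IH (U :\: E) _ (IE _ EU)); last first.
  rewrite -ltnS; apply: leq_trans Un; apply: proper_card; apply/properP.
  split; first exact: subsetDl.
  have /set0Pn[x xE] := H0 EH; exists x; first exact: (subsetP EsU).
  by rewrite inE xE.
rewrite [leRHS]big_mkcond /=; apply: ler_sum => s _.
have -> : U :\: cover [set F in E :: s] = U :\: E :\: cover [set F in s].
  rewrite setDDl; congr (_ :\: _); apply/setP => x; rewrite inE.
  apply/bigcupP/orP => [[F]|[xE|/bigcupP[F]]]; rewrite ?inE.
  - case/predU1P => [->|Fs] xF; [by left|right].
    by apply/bigcupP; exists F; rewrite ?inE.
  - by exists E; rewrite ?inE ?eqxx.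
  - by move=> Fs xF; exists F; rewrite ?inE ?Fs ?orbT.
case: ifP => _; last by rewrite mulr0.
by rewrite delete_meeting_edges_within mulrA divff ?mul1r // gt_eqF.
Qed.

End Supermartingale.

(** * Drift of the potential *)

From mathcomp Require Import all_classical all_reals all_analysis.
Import numFieldNormedType.Exports.
Local Open Scope ring_scope.

(** Inverting [1 - y <= expR (- y)] gives the bound [1 / (1 - y) = 1 + y + y ^+ 2 / (1 - y)], where
    [1 - y >= 1 / 2]. *)
Lemma expR_le_quadratic (R : realType) (y : R) :
  y <= 1 / 2 -> expR y <= 1 + y + 2 * y ^+ 2.
Proof.
move=> y2; have e1 := expR_ge1Dx (- y).
rewrite -[y in expR y]opprK expRN.
have p1 : 0 < 1 - y by lra.
have ylt : (expR (- y))^-1 <= (1 - y)^-1.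
  by rewrite lef_pV2 // ?posrE ?expR_gt0.
apply: le_trans ylt _; rewrite -[leLHS]mul1r ler_pdivrMr //.
have : 0 <= y ^+ 2 * (1 - 2 * y) by rewrite mulr_ge0 ?sqr_ge0 //; lra.
nra.
Qed.

Section PairStep.
Variables (R : realType) (V : finType) (G : {set {set V}}) (U : {set V}).
Variables (r L : nat) (a b lam : R).
Hypothesis Gr : uniform r G.
Hypothesis GU : forall E, E \in G -> E \subset U.
Hypothesis GL : forall u v, u != v -> (pair_degree G u v <= L)%N.
Hypothesis ab : forall u, u \in U -> a <= (deg G u)%:R <= b.
Hypothesis lam0 : 0 <= lam.
Hypothesis lamL : lam * (r%:R * L%:R) <= 1 / 2.

Let ab' (E : {set V}) u : E \in G -> u \in E -> a <= (deg G u)%:R <= b.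
Proof. by move=> /GU/fintype.subsetP EU /EU; exact: ab. Qed.

(** Second-order expansion of the exponential. Losses lie between 0 and [r * L], so the squared
    difference is at most [r * L] times their sum, and both orders reduce to the first moments
    bounded above. *)
Lemma sum_exp_loss_le v w :
  \sum_(E in G | (v \notin E) && (w \notin E))
    expR (lam * ((loss G E w)%:R - (loss G E v)%:R)) <=
  #|G|%:R
  + lam * ((deg G w)%:R * ((r%:R - 1) * b)
           - (deg G v)%:R * ((r%:R - 1) * a - r%:R ^+ 2 * L%:R)
           + (deg G w)%:R * (r%:R * L%:R))
  + 2 * lam ^+ 2 * (r%:R * L%:R)
    * ((deg G v)%:R * ((r%:R - 1) * b) + (deg G w)%:R * ((r%:R - 1) * b)).
Proof.
set lv := fun E => (loss G E v)%:R : R; set lw := fun E => (loss G E w)%:R : R.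
set P := fun E : {set V} => (v \notin E) && (w \notin E).
set B := r%:R * L%:R : R.
have B0 : 0 <= B by rewrite mulr_ge0.
have lvB E : E \in G -> v \notin E -> lv E <= B.
  by move=> EG vE; rewrite /lv /B -natrM ler_nat (loss_le Gr GL).
have lwB E : E \in G -> w \notin E -> lw E <= B.
  by move=> EG vE; rewrite /lw /B -natrM ler_nat (loss_le Gr GL).
have lv0 E : 0 <= lv E by rewrite /lv.
have lw0 E : 0 <= lw E by rewrite /lw.
have term E : E \in G -> P E -> expR (lam * (lw E - lv E)) <=
   1 + lam * (lw E - lv E) + 2 * lam ^+ 2 * B * (lv E + lw E).
  move=> EG /andP[vE wE]; have := lvB _ EG vE; have := lwB _ EG wE.
  have := lv0 E; have := lw0 E.
  move: (lv E) (lw E) => x y y0 x0 yB xB.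
  apply: (le_trans (expR_le_quadratic _)).
    apply: le_trans lamL; apply: ler_wpM2l => //; rewrite -/B; lra.
  have xx : 0 <= x * (B - x) by rewrite mulr_ge0 // subr_ge0.
  have yy : 0 <= y * (B - y) by rewrite mulr_ge0 // subr_ge0.
  have xy : 0 <= x * y by rewrite mulr_ge0.
  rewrite lerD2l exprMn mulrA -[leRHS]mulrA; apply: ler_wpM2l.
    by rewrite mulr_ge0 ?sqr_ge0.
  by rewrite expr2; lra.
apply: (@le_trans _ _ (\sum_(E in G | P E)
   (1 + lam * (lw E - lv E) + 2 * lam ^+ 2 * B * (lv E + lw E)))).
  by apply: ler_sum => E /andP[]; exact: term.
rewrite !big_split /= -!mulr_sumr !big_split /= sumrN.
have s1 : \sum_(E in G | P E) 1 <= #|G|%:R :> R.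
  rewrite -sum1_card natr_sum big_mkcondr; apply: ler_sum => E _.
  by case: ifP.
have swub : \sum_(E in G | P E) lw E <= (deg G w)%:R * ((r%:R - 1) * b).
  apply: le_trans (sum_loss_le Gr ab' w); rewrite [leRHS]big_mkcondr big_mkcondr.
  by apply: ler_sum => E _; rewrite /P; case: (v \in E); case: (w \in E) => //=; apply: lw0.
have svub : \sum_(E in G | P E) lv E <= (deg G v)%:R * ((r%:R - 1) * b).
  apply: le_trans (sum_loss_le Gr ab' v); rewrite [leRHS]big_mkcondr big_mkcondr.
  by apply: ler_sum => E _; rewrite /P; case: (v \in E); case: (w \in E) => //=; apply: lv0.
(* The sum omits the edges through [w]; there are [deg G w] of them, and each that avoids [v] costs
   [v] at most [B]. *)
have svlb : (deg G v)%:R * ((r%:R - 1) * a - r%:R ^+ 2 * L%:R)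
    - (deg G w)%:R * B <= \sum_(E in G | P E) lv E.
  rewrite lerBlDr; apply: le_trans (sum_loss_ge Gr GL ab' v) _.
  have -> : (deg G w)%:R = \sum_(E in G | w \in E) 1%:R :> R.
    by rewrite -natr_sum sum1dep_card.
  rewrite mulr_suml [leLHS]big_mkcondr.
  rewrite [X in X + _]big_mkcondr [X in _ + X]big_mkcondr -big_split /=.
  apply: ler_sum => E EG; rewrite /P mul1r.
  have := @lvB E EG; have := lv0 E.
  case: (v \in E); case: (w \in E) => //= l0; rewrite ?add0r ?addr0 //; last by move/(_ isT).
have lam2 : 0 <= 2 * lam ^+ 2 * B by rewrite !mulr_ge0 ?sqr_ge0.
apply: lerD; last by apply: ler_wpM2l => //; apply: lerD.
apply: lerD => //; apply: ler_wpM2l => //.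
move: svlb swub; rewrite -/B; lra.
Qed.

End PairStep.

(** All error terms are multiples of the least degree [a], in total at most [r * (K + 10 * r) * a],
    and averaging degrees gives [a <= r * q / n]. *)
Lemma drift_le (R : realType) (q n r L D a b eps lam K dv dw : R) :
  0 < n -> 1 <= r -> 0 <= L -> 0 < a -> 0 <= lam -> 0 <= K -> 0 <= eps ->
  n * a <= r * q -> a <= dv <= b -> a <= dw <= b -> b <= D -> b <= a + eps ->
  eps <= a -> lam * eps ^+ 2 <= a -> lam * L <= 1 -> lam ^+ 2 * (L * D) <= 1 ->
  lam * (eps - (dv - dw)) <= K ->
  q + lam * (dw * ((r - 1) * b) - dv * ((r - 1) * a - r ^+ 2 * L) + dw * (r * L))
    + 2 * lam ^+ 2 * (r * L) * (dv * ((r - 1) * b) + dw * ((r - 1) * b))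
  <= q * (1 + r ^+ 2 * (K + 10 * r) / n).
Proof.
move=> n0 r1 L0 a0 lam0 K0 eps0 naq /andP[av vb] /andP[aw wb] bD bae epsa le2 lL l2 lK.
have r0 : 0 < r by lra.
have b0 : 0 < b by lra.
(* Insert [b <= a + eps] and [dw <= a + eps]: the restoring term [a * (eps - (dv - dw))] costs
   [a * K] after scaling by [lam], and [eps ^+ 2] costs [a]. *)
have main : lam * (dw * b - dv * a) <= a * K + a.
  have : dw * b - dv * a <= a * (eps - (dv - dw)) + eps ^+ 2.
    rewrite expr2; nra.
  move=> /(ler_wpM2l lam0); nra.
have corr : lam * (dv * (r ^+ 2 * L) + dw * (r * L)) <= 2 * a * (r ^+ 2 + r).
  have h1 : dv * (r ^+ 2 * L) + dw * (r * L) <= (2 * a * (r ^+ 2 + r)) * L.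
    have : dv * (r ^+ 2 * L) <= (2 * a) * (r ^+ 2 * L).
      by apply: ler_wpM2r; [rewrite mulr_ge0 ?sqr_ge0 | lra].
    have : dw * (r * L) <= (2 * a) * (r * L).
      by apply: ler_wpM2r; [rewrite mulr_ge0 // ltW | lra].
    lra.
  apply: le_trans (ler_wpM2l lam0 h1) _.
  have -> : lam * (2 * a * (r ^+ 2 + r) * L) = 2 * a * (r ^+ 2 + r) * (lam * L) by ring.
  rewrite ler_piMr // !mulr_ge0 ?addr_ge0 ?sqr_ge0 //; lra.
have quad : 2 * lam ^+ 2 * (r * L) * (dv * ((r - 1) * b) + dw * ((r - 1) * b))
    <= 8 * r * (r - 1) * a.
  have h1 : (dv + dw) * b <= 4 * a * D.
    apply: (@le_trans _ _ (4 * a * b)); first by apply: ler_wpM2r; lra.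
    by apply: ler_wpM2l => //; lra.
  have -> : 2 * lam ^+ 2 * (r * L) * (dv * ((r - 1) * b) + dw * ((r - 1) * b)) =
     (2 * r * (r - 1)) * (lam ^+ 2 * L) * ((dv + dw) * b) by ring.
  have c0 : 0 <= 2 * r * (r - 1) by rewrite !mulr_ge0 //; lra.
  have c1 : 0 <= (2 * r * (r - 1)) * (lam ^+ 2 * L).
    by rewrite mulr_ge0 // mulr_ge0 // sqr_ge0.
  apply: le_trans (ler_wpM2l c1 h1) _.
  have -> : 2 * r * (r - 1) * (lam ^+ 2 * L) * (4 * a * D) =
    8 * r * (r - 1) * a * (lam ^+ 2 * (L * D)) by ring.
  by rewrite ler_piMr // !mulr_ge0 //; lra.
have qn : a * (r * (K + 10 * r)) <= q * (r ^+ 2 * (K + 10 * r) / n).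
  have -> : q * (r ^+ 2 * (K + 10 * r) / n) = (r * q / n) * (r * (K + 10 * r)).
    by field; lra.
  apply: ler_wpM2r; first by rewrite mulr_ge0 //; lra.
  by rewrite ler_pdivlMr // mulrC.
have : (r - 1) * (lam * (dw * b - dv * a)) <= (r - 1) * (a * K + a).
  by apply: ler_wpM2l => //; lra.
have : 0 <= a * (K + 5 * r + 1) by rewrite mulr_ge0 //; lra.
move: main corr quad qn; nra.
Qed.

(** * The potential and its one-step inequality *)

Section Potential.
Variables (R : realType) (V : finType) (H : {set {set V}}) (r : nat).
Variables (lam eta : R) (g : nat -> R).
Implicit Types (U : {set V}) (u v w : V).

Definition degree_gap U v w : R :=
  (deg (edges_within H U) v)%:R - (deg (edges_within H U) w)%:R.

(** The last summand is a reserve: each step removes a vertex and so releases at least [eta], which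
    pays for the pairs far below the barrier. *)
Definition potential U : R :=
  \sum_(v in U) \sum_(w in U) expR (lam * degree_gap U v w - g #|U|)
  + #|U|%:R * eta.

Lemma deg_edges_within U v : (deg (edges_within H U) v <= deg H v)%N.
Proof.
apply: subset_leq_card; apply/fintype.subsetP => E.
by rewrite !inE => /andP[/andP[-> _] ->].
Qed.

Variables (D : nat) (K Gm : R).
Hypotheses (Hr : uniform r H) (r_gt0 : (0 < r)%N).
Hypothesis HD : forall v, (deg H v <= D)%N.
Hypothesis lam_gt0 : 0 < lam.
Let L := max_pair_degree H.
Hypothesis lamL : lam * (r%:R * L%:R) <= 1 / 2.
Hypothesis lam2LD : lam ^+ 2 * (L%:R * D%:R) <= 1.
Hypotheses (K_ge0 : 0 <= K) (Gm_ge1 : 1 <= Gm).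

Section Step.
Variable U : {set V}.
Let n := #|U|.
Let G := edges_within H U.
Hypothesis n_gt0 : (0 < n)%N.
Hypothesis gGm : g n <= Gm.
Hypothesis gap_le : forall v w, v \in U -> w \in U -> lam * degree_gap U v w <= g n.
Hypothesis deg_ge : forall v, v \in U -> Gm ^+ 2 / lam <= (deg G v)%:R.
Hypothesis g_step : g n + r%:R ^+ 2 * (K + 10 * r%:R) / n%:R <= g (n - r)%N.
Hypothesis eta_ge : n%:R ^+ 2 * expR (1 - K) <= eta.

Let Gr : uniform r G := uniform_edges_within Hr.
Let GL u v : u != v -> (pair_degree G u v <= L)%N := @pair_degree_edges_within _ H U u v.
Let GU E : E \in G -> E \subset U.
Proof. by rewrite inE => /andP[]. Qed.

Lemma degree_gap_setD v w E : degree_gap (U :\: E) v w =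
  degree_gap U v w + ((loss G E w)%:R - (loss G E v)%:R).
Proof.
rewrite /degree_gap -delete_meeting_edges_within -/G -(loss_deg G E v) -(loss_deg G E w).
by rewrite !natrD; ring.
Qed.

Lemma g_mono : g n <= g (n - r)%N.
Proof.
by apply: le_trans g_step; rewrite lerDl !mulr_ge0 ?addr_ge0 ?sqr_ge0 ?invr_ge0.
Qed.

Lemma sum_exp_gap_le v w : v \in U -> w \in U ->
  \sum_(E in G | (v \notin E) && (w \notin E))
    expR (lam * degree_gap (U :\: E) v w - g (n - r)%N) <=
  #|G|%:R * (expR (lam * degree_gap U v w - g n) + expR (1 - K)).
Proof.
move=> vU wU.
have [gK|gK] := lerP (g n - lam * degree_gap U v w) K; last first.
  apply: (@le_trans _ _ (#|G|%:R * expR (1 - K))); last first.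
    by apply: ler_wpM2l => //; rewrite lerDr expR_ge0.
  rewrite -sumr_const mulr_suml big_mkcondr; apply: ler_sum => E EG; rewrite mul1r.
  case: ifP => [/andP[vE wE]|_]; last exact: expR_ge0.
  rewrite ler_expR degree_gap_setD mulrDr.
  have lw : (loss G E w)%:R - (loss G E v)%:R <= r%:R * L%:R :> R.
    apply: (@le_trans _ _ (loss G E w)%:R); first by rewrite lerBlDr lerDl.
    by rewrite -natrM ler_nat (loss_le Gr GL).
  have := ler_wpM2l (ltW lam_gt0) lw; have := g_mono; move: lamL gK; lra.
apply: (@le_trans _ _ (#|G|%:R * expR (lam * degree_gap U v w - g n))); last first.
  by apply: ler_wpM2l => //; rewrite lerDl expR_ge0.
under eq_bigr => E _.
  have -> : lam * degree_gap (U :\: E) v w - g (n - r)%N =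
     (lam * degree_gap U v w - g (n - r)%N) + lam * ((loss G E w)%:R - (loss G E v)%:R).
    by rewrite degree_gap_setD; ring.
  rewrite expRD; over.
rewrite -mulr_sumr.
set x := lam * degree_gap U v w - g (n - r)%N.
have -> : lam * degree_gap U v w - g n = x + (g (n - r)%N - g n).
  by rewrite /x; ring.
rewrite [expR (x + _)]expRD mulrCA; apply: ler_wpM2l; first exact: expR_ge0.
case: (arg_minnP (fun u => deg G u) vU) => u0 u0U min_u0.
case: (arg_maxnP (fun u => deg G u) vU) => u1 u1U max_u1.
pose a : R := (deg G u0)%:R; pose b : R := (deg G u1)%:R.
have ab u : u \in U -> a <= (deg G u)%:R <= b.
  by move=> uU; rewrite !ler_nat min_u0 //=; exact: max_u1.
have a_ge : Gm ^+ 2 / lam <= a by exact: deg_ge.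
have g_ge0 : 0 <= g n by have := gap_le vU vU; rewrite /degree_gap subrr mulr0.
have a_gt0 : 0 < a.
  by apply: lt_le_trans a_ge; rewrite divr_gt0 ?exprn_gt0 ?(lt_le_trans ltr01 Gm_ge1).
apply: le_trans (sum_exp_loss_le Gr GU GL ab (ltW lam_gt0) lamL v w) _.
have K' : lam * (g n / lam - ((deg G v)%:R - (deg G w)%:R)) <= K.
  by rewrite mulrBr mulrCA divff ?gt_eqF // mulr1.
have r1 : 1 <= r%:R :> R by rewrite ler1n.
have ga : g n / lam <= a.
  apply: le_trans a_ge; rewrite ler_pM2r ?invr_gt0 //; apply: le_trans gGm _.
  by rewrite ler_eXnr.
have naq : n%:R * a <= r%:R * #|G|%:R.
  rewrite -natrM -(sum_deg_uniform Gr GU) natr_sum -sumr_const mulr_suml.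
  by apply: ler_sum => u uU; rewrite mul1r; case/andP: (ab u uU).
(* Here [eps] is [g n / lam], so the gap hypothesis reads [b <= a + eps]; the degree lower bound
   [Gm ^+ 2 / lam] yields both [eps <= a] and [lam * eps ^+ 2 <= a]. *)
apply: le_trans (@drift_le R #|G|%:R n%:R r%:R L%:R D%:R a b (g n / lam) lam K
  (deg G v)%:R (deg G w)%:R _ r1 _ a_gt0 (ltW lam_gt0) K_ge0 _ naq (ab v vU)
  (ab w wU) _ _ ga _ _ lam2LD K') _ => //.
- by rewrite ltr0n.
- by rewrite divr_ge0 // ltW.
- by rewrite ler_nat; apply: leq_trans (HD u1); exact: deg_edges_within.
- rewrite addrC -lerBlDr ler_pdivlMr // mulrC; exact: gap_le.
- have -> : lam * (g n / lam) ^+ 2 = g n ^+ 2 / lam.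
    by field; rewrite gt_eqF.
  apply: le_trans a_ge; rewrite ler_pM2r ?invr_gt0 //.
  by rewrite ler_pXn2r ?nnegrE // (le_trans ler01 Gm_ge1).
- apply: le_trans (_ : lam * (r%:R * L%:R) <= _); last by move: lamL; lra.
  by apply: ler_wpM2l; [exact: ltW | rewrite ler_peMl].
apply: ler_wpM2l => //; apply: le_trans (expR_ge1Dx _) _.
by rewrite ler_expR; move: g_step; lra.
Qed.

Lemma sum_potential_le :
  \sum_(E in G) potential (U :\: E) <= #|G|%:R * potential U.
Proof.
have cardD E : E \in G -> #|U :\: E| = (n - r)%N.
  by move=> EG; rewrite cardsD (finset.setIidPr (GU EG)) (Gr EG).
rewrite /potential big_split /= mulrDr.
have -> : \sum_(E in G) #|U :\: E|%:R * eta = #|G|%:R * ((n - r)%N%:R * eta).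
  by rewrite mulr_natl -sumr_const; apply: eq_bigr => E /cardD ->.
have -> : \sum_(E in G) \sum_(v in U :\: E) \sum_(w in U :\: E)
    expR (lam * degree_gap (U :\: E) v w - g #|U :\: E|) =
  \sum_(v in U) \sum_(w in U) \sum_(E in G | (v \notin E) && (w \notin E))
    expR (lam * degree_gap (U :\: E) v w - g (n - r)%N).
  transitivity (\sum_(E in G) \sum_(v in U) \sum_(w in U)
      if (v \notin E) && (w \notin E) then
      expR (lam * degree_gap (U :\: E) v w - g (n - r)%N) else 0).
    apply: eq_bigr => E EG; rewrite (cardD _ EG) big_mkcond [RHS]big_mkcond /=.
    apply: eq_bigr => v _; rewrite !inE andbC.
    case: (v \in U) => //=; case: (v \notin E) => /=; last by rewrite big1.
    rewrite big_mkcond [RHS]big_mkcond /=; apply: eq_bigr => w _.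
    by rewrite !inE andbC; case: (w \in U).
  rewrite exchange_big /=; apply: eq_bigr => v _.
  rewrite exchange_big /=; apply: eq_bigr => w _.
  by rewrite -big_mkcondr.
apply: (@le_trans _ _ (#|G|%:R * (\sum_(v in U) \sum_(w in U)
   expR (lam * degree_gap U v w - g n) + n%:R ^+ 2 * expR (1 - K)) +
   #|G|%:R * ((n - r)%N%:R * eta))).
  rewrite lerD2r.
  have -> : n%:R ^+ 2 * expR (1 - K) = \sum_(v in U) \sum_(w in U) expR (1 - K).
    by rewrite !sumr_const -/n -mulrnA -[RHS]mulr_natl natrM expr2.
  rewrite -big_split mulr_sumr; apply: ler_sum => v vU /=.
  by rewrite -big_split mulr_sumr; apply: ler_sum => w wU; exact: sum_exp_gap_le.
rewrite -!mulrDr ler_wpM2l // -addrA lerD2l.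
have eta0 : 0 <= eta by apply: le_trans eta_ge; rewrite mulr_ge0 ?sqr_ge0 ?expR_ge0.
apply: (@le_trans _ _ ((1 + (n - r)%N)%N%:R * eta)).
  by rewrite natrD mulrDl mul1r lerD2r.
by apply: ler_wpM2r => //; rewrite ler_nat -/n; lia.
Qed.

End Step.
End Potential.

(** * The finite bound *)

Lemma expr1B_le (R : realFieldType) (y : R) k :
  0 <= y <= 1 -> (1 - y) ^+ k * (1 + k%:R * y) <= 1.
Proof.
move=> /andP[y0 y1]; elim: k => [|k IH]; first by rewrite expr0 !mul0r addr0 mulr1.
apply: le_trans IH; rewrite exprSr -mulrA; apply: ler_wpM2l.
  by rewrite exprn_ge0 // subr_ge0.
have : 0 <= k%:R * y ^+ 2 by rewrite mulr_ge0 ?sqr_ge0.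
have := sqr_ge0 y; rewrite -natr1; nra.
Qed.

Lemma expr1B_ge (R : realFieldType) (y : R) k :
  0 <= y <= 1 -> 1 - k%:R * y <= (1 - y) ^+ k.
Proof.
move=> /andP[y0 y1]; elim: k => [|k IH]; first by rewrite expr0 mul0r subr0.
have p : 0 <= 1 - y by lra.
have := ler_wpM2l p IH; rewrite exprS; apply: le_trans.
have : 0 <= k%:R * y ^+ 2 by rewrite mulr_ge0 ?sqr_ge0.
rewrite -natr1; nra.
Qed.

(* With [m = n - r^2], this is [(1 - r/m)^r <= 1 / (1 + r^2/m)], and
   [1 / (1 + r^2/m) = 1 - r^2/n] exactly: the shift by [r^2] is what makes the
   trajectory below decrease at least as fast as the number of edges. *)
Lemma shifted_power_le (R : realFieldType) (r : nat) (n : R) :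
  r%:R ^+ 2 + r%:R <= n -> (0 < r)%N ->
  (n - r%:R - r%:R ^+ 2) ^+ r <= (n - r%:R ^+ 2) ^+ r * (1 - r%:R ^+ 2 / n).
Proof.
move=> rn r0; have r1 : 1 <= r%:R :> R by rewrite ler1n.
have r2 := sqr_ge0 (r%:R : R).
set m := n - r%:R ^+ 2; have m0 : 0 < m by rewrite /m; lra.
have n0 : 0 < n by lra.
have -> : n - r%:R - r%:R ^+ 2 = m * (1 - r%:R / m).
  by rewrite mulrBr mulr1 mulrCA divff ?gt_eqF // /m; ring.
rewrite exprMn; apply: ler_wpM2l; first by rewrite exprn_ge0 // ltW.
have y01 : 0 <= r%:R / m <= 1.
  by rewrite divr_ge0 ?(ltW m0) //= ler_pdivrMr // mul1r /m; lra.
have := expr1B_le r y01.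
have -> : 1 + r%:R * (r%:R / m) = n / m.
  have -> : n = m + r%:R ^+ 2 by rewrite /m subrK.
  by field; rewrite gt_eqF.
rewrite mulrA ler_pdivrMr // mul1r -ler_pdivlMr //.
by have -> : m / n = 1 - r%:R ^+ 2 / n by rewrite /m mulrBl divff ?gt_eqF.
Qed.

Section Finitary.
Variables (R : realType) (V : finType) (H : {set {set V}}) (r D : nat).
Hypotheses (r_ge2 : (2 <= r)%N) (Hr : uniform r H) (HD : regular D H).
Hypothesis D_gt0 : (0 < D)%N.
Let N := #|V|.
Let L := max_pair_degree H.
Let l : R := ln N%:R.
Hypothesis l_ge : 544 * r%:R ^+ 6 <= l.
Let lam : R := (Num.sqrt (L%:R * D%:R))^-1.
Let Gm : R := 16 * r%:R ^+ 3 * l ^+ 2.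
(** Chosen so that [expR (1 - K)] is [N ^- 4]: the at most [N ^ 2] pairs together cost at most [eta]
    per step. *)
Let K : R := 1 + 4 * l.
Let A : R := r%:R ^+ 2 * (K + 10 * r%:R).
(* The increment [g (n - r) - g n >= A / n] absorbs the drift and the variance of
   the gaps that are within [K / lam] of the barrier; pairs further away weigh at
   most [expR (- K)] and are paid for by [eta]. *)
Let g (n : nat) : R := 3 * l + A * (l - ln n%:R).
Let eta : R := N%:R ^- 2.
Let x0 : R := (L%:R / D%:R) `^ (1 / (2 * (r%:R - 1))) * l ^+ 5.

Let r2 : 2 <= r%:R :> R. Proof. by rewrite ler_nat. Qed.

Let l_gt1 : 1 < l.
Proof.
apply: lt_le_trans l_ge; have : 1 <= r%:R ^+ 6 :> R by rewrite exprn_ege1 //; move: r2; lra.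
lra.
Qed.

Let N_gt0 : (0 < N)%N.
Proof.
rewrite lt0n; apply/eqP => N0; move: l_gt1; rewrite /l N0 ln0 //.
by rewrite ltr10.
Qed.

Let D_le_NL : (D <= N * L)%N.
Proof.
have /card_gt0P[v _] := N_gt0.
have GL u w : u != w -> (pair_degree H u w <= L)%N.
  by rewrite -{1}(edges_withinT H); exact: pair_degree_edges_within.
by have := deg_le_mul_pair_degree Hr GL v r_ge2; rewrite /deg HD.
Qed.

Let L_gt0 : (0 < L)%N.
Proof. by have := leq_trans D_gt0 D_le_NL; rewrite muln_gt0 => /andP[]. Qed.

Let LD_gt0 : 0 < L%:R * D%:R :> R. Proof. by rewrite mulr_gt0 ?ltr0n. Qed.
Let lam_gt0 : 0 < lam. Proof. by rewrite invr_gt0 sqrtr_gt0. Qed.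

Let lam2 : lam ^+ 2 * (L%:R * D%:R) = 1.
Proof. by rewrite exprVn sqr_sqrtr ?ltW // mulVf // gt_eqF. Qed.

Let lamL : lam * L%:R = (lam * D%:R)^-1.
Proof.
apply: (@mulIf _ (lam * D%:R)); first by rewrite mulf_neq0 ?gt_eqF // ltr0n.
rewrite mulVf ?mulf_neq0 ?gt_eqF ?ltr0n // -[RHS]lam2; ring.
Qed.

Let r6 : r%:R + 1 <= r%:R ^+ 3 :> R.
Proof. by move: r2; rewrite !exprS expr0; nra. Qed.

Let Gm_ge1 : 1 <= Gm.
Proof.
have h : 1 <= l ^+ 2 by rewrite exprn_ege1 // ltW.
by rewrite /Gm; move: r6 r2; nra.
Qed.

(** Origin of the constant 544 and of the power 5: [r + 1 + Gm] is at most [17 * r ^+ 3 * l ^+ 2],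
    [544 = 2 * 17 * 16], and the fifth factor [l] absorbs [544 * r ^+ 6]. *)
Let Gm_bound : 2 * (r%:R + 1 + Gm) * Gm <= l ^+ 5.
Proof.
have l2 : 1 <= l ^+ 2 by rewrite exprn_ege1 // ltW.
apply: (@le_trans _ _ (544 * r%:R ^+ 6 * l ^+ 4)); last first.
  by rewrite [l ^+ 5]exprS ler_wpM2r // exprn_ge0 // ltW // (lt_trans ltr01).
have h : r%:R + 1 + Gm <= 17 * r%:R ^+ 3 * l ^+ 2.
  have r3 : 0 <= r%:R ^+ 3 :> R by rewrite exprn_ge0.
  by have := ler_wpM2l r3 l2; rewrite /Gm; move: r6; lra.
have -> : 544 * r%:R ^+ 6 * l ^+ 4 = 2 * (17 * r%:R ^+ 3 * l ^+ 2) * Gm.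
  by rewrite /Gm; ring.
by apply: ler_wpM2r; [move: Gm_ge1; lra | apply: ler_wpM2l].
Qed.

Let A_le : 3 * l + A * l <= Gm.
Proof.
have l2 : l <= l ^+ 2 by rewrite expr2; move: l_gt1; nra.
have l0 : 0 <= l by rewrite ltW // (lt_trans ltr01).
have hA : A <= 15 * r%:R ^+ 3 * l.
  have h : K + 10 * r%:R <= 15 * r%:R * l by rewrite /K; move: l_gt1 r2; nra.
  apply: le_trans (ler_wpM2l (sqr_ge0 (r%:R : R)) h) _.
  by rewrite le_eqVlt; apply/orP; left; apply/eqP; ring.
have h3 : 3 * l <= r%:R ^+ 3 * l ^+ 2 by apply: ler_pM => //; move: r6 r2; lra.
have -> : Gm = r%:R ^+ 3 * l ^+ 2 + 15 * r%:R ^+ 3 * l * l by rewrite /Gm; ring.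
by apply: lerD => //; exact: ler_wpM2r.
Qed.

(** The exponent of [x0] is chosen so that its power [r.-1] contains the square root of [L / D],
    which equals [1 / (lam * D)]. *)
Let x0_pow : l ^+ 5 / (lam * D%:R) <= x0 ^+ r.-1.
Proof.
have r1 : r.-1%:R = r%:R - 1 :> R by rewrite -subn1 natrB // ltnW.
have LD : L%:R / D%:R = (lam * D%:R)^-1 ^+ 2.
  rewrite -lamL exprMn; apply: (canLR (mulfK _)); first by rewrite pnatr_eq0 -lt0n.
  rewrite -[LHS]mul1r -[X in X * _]lam2; ring.
have lD0 : 0 <= (lam * D%:R)^-1 by rewrite invr_ge0 mulr_ge0 // ltW.
rewrite /x0 exprMn -[_ `^ _ ^+ _]powR_mulrn ?powR_ge0 // -powRrM r1.
have -> : 1 / (2 * (r%:R - 1)) * (r%:R - 1) = 2^-1 :> R by field; move: r2; lra.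
rewrite powR12_sqrt ?divr_ge0 // LD sqrtr_sqr ger0_norm // mulrC.
apply: ler_wpM2l => //; rewrite -exprM ler_weXn2l ?ltW //.
by rewrite leq_pmulr // -ltnS prednK // ltnW.
Qed.

Let e : R := Gm / lam.
Let e_ge0 : 0 <= e.
Proof. by rewrite divr_ge0 ?(le_trans ler01 Gm_ge1) // ltW. Qed.

(* [edge_bound n] is kept below the number of edges because, when the gaps are
   at most [e], a step removes at most [r (r q / n + e)] of the [q] edges. *)
Let edge_bound (n : R) : R :=
  D%:R / (r%:R * N%:R ^+ r.-1) * (n - r%:R ^+ 2) ^+ r - e * n.

(** * One step from a large unsaturated set *)

Section LargeSet.
Variable U : {set V}.
Let n := #|U|.
Let G := edges_within H U.
Hypothesis n_gt : N%:R * x0 < n%:R.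
Hypothesis G_ge : edge_bound n%:R <= #|G|%:R.
Hypothesis gap_le : forall v w, v \in U -> w \in U ->
  lam * degree_gap R H U v w <= g n.

Let Gr : uniform r G := uniform_edges_within Hr.
Let GU E : E \in G -> E \subset U.
Proof. by rewrite inE => /andP[]. Qed.

Let N0 : 0 < N%:R :> R. Proof. by rewrite ltr0n. Qed.
Let D0 : 0 < D%:R :> R. Proof. by rewrite ltr0n. Qed.
Let l0 : 0 <= l. Proof. by rewrite ltW // (lt_trans ltr01). Qed.
Let lamD0 : 0 < lam * D%:R. Proof. by rewrite mulr_gt0. Qed.

Let x0_ge0 : 0 <= x0.
Proof. by rewrite mulr_ge0 ?powR_ge0 ?exprn_ge0. Qed.

Let n0 : 0 < n%:R :> R.
Proof. by apply: le_lt_trans n_gt; rewrite mulr_ge0. Qed.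

Let n_le_N : n%:R <= N%:R :> R.
Proof. by rewrite ler_nat max_card. Qed.

Let p : R := n%:R / N%:R.
Let p01 : 0 <= p <= 1.
Proof. by rewrite divr_ge0 //= ler_pdivrMr // mul1r. Qed.

Let p_pow : l ^+ 5 / (lam * D%:R) <= p ^+ r.-1.
Proof.
have /andP[p0 _] := p01.
apply: le_trans x0_pow _; apply: lerXn2r; rewrite ?nnegrE //.
by rewrite ler_pdivlMr // mulrC ltW.
Qed.

(** No separate assumption on [L / D] is made: a set of more than [N * x0] vertices has density
    [p <= 1], which bounds [l ^+ 5 / (lam * D)] by 1. *)
Let lamD_ge : l ^+ 5 <= lam * D%:R.
Proof.
have /andP[p0 p1] := p01.
have : l ^+ 5 / (lam * D%:R) <= 1 by apply: le_trans p_pow _; rewrite exprn_ile1.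
by rewrite ler_pdivrMr // mul1r.
Qed.

Let l5_ge_r : 2 * r%:R <= l ^+ 5.
Proof.
apply: le_trans Gm_bound; have := Gm_ge1; have := r2.
move: (Gm) => x; nra.
Qed.

Let lamLr : lam * (r%:R * L%:R) <= 1 / 2.
Proof.
rewrite mulrCA lamL ler_pdivrMr //; move: lamD_ge l5_ge_r; lra.
Qed.

(** From [D <= N * L] follows [N * (lam * L) ^+ 2 >= 1], hence [N * (lam * L) >= 1]. As
    [p >= p ^+ r.-1 >= l ^+ 5 * (lam * L)], this gives [n = N * p >= l ^+ 5]. *)
Let n_ge : 2 * r%:R ^+ 3 <= n%:R :> R.
Proof.
have /andP[p0 p1] := p01.
have h1 : 2 * r%:R ^+ 3 <= l ^+ 5.
  apply: (@le_trans _ _ l); last first.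
    by rewrite -[leLHS]expr1 ler_weXn2l // ltW.
  apply: le_trans l_ge.
  have -> : r%:R ^+ 6 = r%:R ^+ 3 * r%:R ^+ 3 :> R by ring.
  by move: r6 r2; move: (r%:R ^+ 3 : R) => x; nra.
have lamL0 : 0 <= lam * L%:R by rewrite mulr_ge0 // ltW.
have lamL1 : lam * L%:R <= 1.
  apply: (@le_trans _ _ (lam * (r%:R * L%:R))).
    by apply: ler_wpM2l; [exact: ltW | rewrite ler_peMl //; move: r2; lra].
  by move: lamLr; lra.
have NL : 1 <= N%:R * (lam * L%:R).
  apply: (@le_trans _ _ (N%:R * (lam * L%:R) ^+ 2)); last first.
    by apply: ler_wpM2l => //; rewrite expr2 ler_piMl.
  have -> : N%:R * (lam * L%:R) ^+ 2 = lam ^+ 2 * (L%:R * (N%:R * L%:R)) by ring.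
  rewrite -[leLHS]lam2; apply: ler_wpM2l; first exact: sqr_ge0.
  by apply: ler_wpM2l => //; rewrite -natrM ler_nat.
have pp : p ^+ r.-1 <= p.
  by rewrite -[leRHS]expr1 ler_wiXn2l //; case: r r_ge2 => [|[]].
have : l ^+ 5 * (lam * L%:R) <= p by rewrite lamL; exact: le_trans pp.
move=> /(ler_wpM2l (ltW N0)).
rewrite mulrCA [N%:R * p]mulrCA divff ?gt_eqF // mulr1; apply: le_trans.
by apply: le_trans h1 _; rewrite ler_peMr // exprn_ge0.
Qed.

Let r_le_n : r%:R ^+ 2 + r%:R <= n%:R :> R.
Proof. apply: le_trans n_ge; move: r2; rewrite !exprS expr0; nra. Qed.

Let g_le : g n <= Gm.
Proof.
have A0 : 0 <= A by rewrite mulr_ge0 ?sqr_ge0 // /K; move: l0 r2; lra.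
apply: le_trans A_le; rewrite lerD2l; apply: ler_wpM2l => //.
by rewrite lerBlDr lerDl ln_ge0 // ler1n -(ltr0n R).
Qed.

Let gap_le_e v w : v \in U -> w \in U ->
  (deg G v)%:R <= (deg G w)%:R + e.
Proof.
move=> vU wU; rewrite -lerBlDl ler_pdivlMr // mulrC.
exact: le_trans (gap_le vU wU) g_le.
Qed.

Let sum_degR : \sum_(w in U) (deg G w)%:R = r%:R * #|G|%:R :> R.
Proof. by rewrite -natrM -(sum_deg_uniform Gr GU) natr_sum. Qed.

Let deg_ge_avg v : v \in U -> r%:R * #|G|%:R / n%:R - e <= (deg G v)%:R.
Proof.
move=> vU; rewrite lerBlDr ler_pdivrMr // -sum_degR mulrC mulr_natl -sumr_const.
by apply: ler_sum => w wU; exact: gap_le_e.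
Qed.

Let deg_le_avg v : v \in U -> (deg G v)%:R <= r%:R * #|G|%:R / n%:R + e.
Proof.
move=> vU; rewrite -lerBlDr ler_pdivlMr // -sum_degR mulrC mulr_natl -sumr_const.
by apply: ler_sum => w wU; rewrite lerBlDr; exact: gap_le_e.
Qed.

(** The edge bound makes the average degree at least [D * p ^+ r.-1 / 2 - r * e]. By [Gm_bound] the
    first term is at least [(r + 1 + Gm) * e], so [Gm * e] remains after subtracting the gap [e]. *)
Let deg_ge v : v \in U -> Gm ^+ 2 / lam <= (deg G v)%:R.
Proof.
move=> vU; apply: le_trans (deg_ge_avg vU).
have rS : r = r.-1.+1 by case: r r_ge2.
have half : n%:R ^+ r / 2 <= (n%:R - r%:R ^+ 2) ^+ r :> R.
  have -> : n%:R - r%:R ^+ 2 = n%:R * (1 - r%:R ^+ 2 / n%:R) :> R.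
    by rewrite mulrBr mulr1 mulrCA divff ?mulr1 // gt_eqF.
  rewrite exprMn; apply: ler_wpM2l; first by rewrite exprn_ge0.
  apply: le_trans (expr1B_ge _ _); last first.
    rewrite divr_ge0 ?sqr_ge0 //= ler_pdivrMr // mul1r.
    by apply: le_trans r_le_n; rewrite lerDl.
  have : r%:R * (r%:R ^+ 2 / n%:R) <= 1 / 2 :> R.
    by rewrite mulrA ler_pdivrMr // -exprS; move: n_ge; lra.
  lra.
have key : D%:R * p ^+ r.-1 / 2 - r%:R * e <= r%:R * #|G|%:R / n%:R.
  rewrite ler_pdivlMr //.
  have : r%:R * edge_bound n%:R <= r%:R * #|G|%:R by apply: ler_wpM2l.
  apply: le_trans; rewrite /edge_bound.
  have -> : r%:R * (D%:R / (r%:R * N%:R ^+ r.-1) * (n%:R - r%:R ^+ 2) ^+ r - e * n%:R)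
    = D%:R / N%:R ^+ r.-1 * (n%:R - r%:R ^+ 2) ^+ r - r%:R * e * n%:R :> R.
    field; rewrite expf_neq0 ?gt_eqF //=; move: r2; lra.
  have -> : (D%:R * p ^+ r.-1 / 2 - r%:R * e) * n%:R =
     D%:R / N%:R ^+ r.-1 * (n%:R ^+ r / 2) - r%:R * e * n%:R :> R.
    rewrite [in n%:R ^+ r]rS exprS /p expr_div_n; field.
    by rewrite expf_neq0 ?gt_eqF.
  by rewrite lerD2r; apply: ler_wpM2l => //; rewrite divr_ge0 ?exprn_ge0.
have pD : 2 * (r%:R + 1 + Gm) * e <= D%:R * p ^+ r.-1.
  have := ler_wpM2l (ltW D0) p_pow; apply: le_trans.
  have -> : D%:R * (l ^+ 5 / (lam * D%:R)) = l ^+ 5 / lam.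
    by field; rewrite !gt_eqF.
  rewrite /e mulrA; apply: ler_wpM2r; last exact: Gm_bound.
  by rewrite invr_ge0 ltW.
have -> : Gm ^+ 2 / lam = Gm * e by rewrite /e expr2 mulrA.
by move: key pD; lra.
Qed.

Let n_pos : (0 < n)%N. Proof. by rewrite -(ltr0n R). Qed.

Let G_neq0 : G != finset.set0.
Proof.
have /card_gt0P[v vU] : (0 < #|U|)%N := n_pos.

apply/eqP => Gset0; have := deg_ge vU; rewrite leNgt => /negP; apply.
have -> : deg G v = 0%N.
  by apply/eqP; rewrite cards_eq0; apply/eqP/finset.setP => E; rewrite Gset0 !inE.
by rewrite divr_gt0 // exprn_gt0 // (lt_le_trans ltr01 Gm_ge1).
Qed.

Let edge_bound_step E : E \in G ->
  edge_bound #|U :\: E|%:R <= #|edges_within H (U :\: E)|%:R.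
Proof.
move=> EG; have r1 : 0 < r%:R :> R by move: r2; lra.
have rn : (r <= n)%N.
  by rewrite -(ler_nat R); apply: le_trans r_le_n; rewrite lerDr sqr_ge0.
have -> : #|U :\: E|%:R = n%:R - r%:R :> R.
  by rewrite cardsD (finset.setIidPr (GU EG)) (Gr EG) natrB.
have del : #|G|%:R - r%:R * (r%:R * #|G|%:R / n%:R + e) <=
    #|edges_within H (U :\: E)|%:R.
  rewrite lerBlDr -delete_meeting_edges_within.
  apply: (@le_trans _ _ (#|delete_meeting G E|%:R + \sum_(u in E) (deg G u)%:R)).
    by rewrite -natr_sum -natrD ler_nat card_delete_meeting_ge.
  rewrite lerD2l; move: (r%:R * _ / _ + e) (@deg_le_avg) => b degb.
  rewrite -(Gr EG) mulr_natl -sumr_const.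
  apply: ler_sum => u uE; apply: degb.
  exact: (fintype.subsetP (GU EG)).
apply: le_trans del.
set c : R := D%:R / (r%:R * N%:R ^+ r.-1).
have c0 : 0 <= c by rewrite divr_ge0 // mulr_ge0 // exprn_ge0.
have F := ler_wpM2l c0 (shifted_power_le r_le_n (ltnW r_ge2)).
have fac : 0 <= 1 - r%:R ^+ 2 / n%:R :> R.
  rewrite subr_ge0 ler_pdivrMr // mul1r; apply: le_trans r_le_n.
  by rewrite lerDl.
have := ler_wpM2r fac G_ge; rewrite /edge_bound -/c.
have -> : #|G|%:R - r%:R * (r%:R * #|G|%:R / n%:R + e) =
  #|G|%:R * (1 - r%:R ^+ 2 / n%:R) - r%:R * e by ring.
have -> : (c * (n%:R - r%:R ^+ 2) ^+ r - e * n%:R) * (1 - r%:R ^+ 2 / n%:R) =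
  c * ((n%:R - r%:R ^+ 2) ^+ r * (1 - r%:R ^+ 2 / n%:R)) - e * n%:R + r%:R ^+ 2 * e.
  by field; rewrite gt_eqF.
(* Slack of the linear terms: scaling [- e * n] by [1 - r ^+ 2 / n] gains [r ^+ 2 * e], while the
   removed edges and the shift to [n - r] cost [r * e] each. *)
have : 0 <= e * (r%:R * (r%:R - 2)).
  by rewrite mulr_ge0 // mulr_ge0 //; move: r2; lra.
move: F; lra.
Qed.

Let eta_ge : n%:R ^+ 2 * expR (1 - K) <= eta.
Proof.
have -> : expR (1 - K) = N%:R ^- 4.
  have -> : 1 - K = - (4 * l) by rewrite /K; ring.
  by rewrite expRN expRM_natl lnK ?posrE.
have -> : eta = N%:R ^+ 2 * N%:R ^- 4.
  by rewrite /eta; field; rewrite gt_eqF.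
by apply: ler_wpM2r; rewrite ?invr_ge0 ?exprn_ge0 // lerXn2r ?nnegrE.
Qed.

Let g_step : g n + r%:R ^+ 2 * (K + 10 * r%:R) / n%:R <= g (n - r)%N.
Proof.
have A0 : 0 <= A by rewrite mulr_ge0 ?sqr_ge0 // /K; move: l0 r2; lra.
have r1 : 1 <= r%:R :> R by move: r2; lra.
have rn : (r <= n)%N.
  by rewrite -(ler_nat R); apply: le_trans r_le_n; rewrite lerDr sqr_ge0.
have rn1 : r%:R / n%:R < 1 :> R.
  rewrite ltr_pdivrMr // mul1r; apply: lt_le_trans r_le_n.
  by rewrite ltrDr exprn_gt0 //; lra.
have lnr : ln (n - r)%N%:R <= ln n%:R - n%:R^-1 :> R.
  have -> : (n - r)%N%:R = n%:R * (1 + - (r%:R / n%:R)) :> R.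
    by rewrite natrB // mulrDr mulr1 mulrN mulrCA divff ?mulr1 // gt_eqF.
  rewrite lnM ?posrE //; last by lra.
  rewrite lerD2l; apply: (@le_trans _ _ (- (r%:R / n%:R))).
    by apply: le_ln1Dx; lra.
  by rewrite lerN2 -[leLHS]mul1r ler_wpM2r ?invr_ge0.
rewrite /g -/A; have := ler_wpM2l A0 lnr; lra.
Qed.

Lemma large_set_step :
  [/\ G != finset.set0,
      forall E, E \in G -> edge_bound #|U :\: E|%:R <= #|edges_within H (U :\: E)|%:R &
      \sum_(E in G) potential H lam eta g (U :\: E) <= #|G|%:R * potential H lam eta g U].
Proof.
split; [exact: G_neq0 | exact: edge_bound_step |].
apply: (@sum_potential_le R V H r lam eta g D K Gm) => //.
- exact: ltnW.
- by move=> v; rewrite /deg HD.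
- by rewrite lam2.
- by rewrite addr_ge0 // mulr_ge0.
Qed.

End LargeSet.

Lemma greedy_pr_unsaturated_gt : greedy_pr R H (fun M => x0 < unsaturated R M) <= 2 / N%:R.
Proof.
have N0 : 0 < N%:R :> R by rewrite ltr0n.
have pot0 U : 0 <= potential H lam eta g U.
  rewrite addr_ge0 ?mulr_ge0 ?invr_ge0 ?sqr_ge0 //.
  by apply: sumr_ge0 => v _; apply: sumr_ge0 => w _; exact: expR_ge0.
have Hne E : E \in H -> E != finset.set0.
  by move=> /Hr EH; rewrite -card_gt0 EH ltnW.
have step (U : {set V}) : edge_bound #|U|%:R <= #|edges_within H U|%:R ->
  [\/ #|U|%:R <= N%:R * x0 /\ 0 <= potential H lam eta g U, 1 <= potential H lam eta g U |
     [/\ edges_within H U != finset.set0,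
      forall E, E \in edges_within H U ->
        edge_bound #|U :\: E|%:R <= #|edges_within H (U :\: E)|%:R &
      \sum_(E in edges_within H U) potential H lam eta g (U :\: E) <=
        #|edges_within H U|%:R * potential H lam eta g U]].
  move=> IU; have [Ux|Ux] := lerP #|U|%:R (N%:R * x0); first by constructor 1.
  have [pot1|pot1] := lerP 1 (potential H lam eta g U); first by constructor 2.
  constructor 3; apply: large_set_step => // v w vU wU.
  (* A gap above the barrier would make its own summand exceed 1, so a potential below 1 controls
     all gaps at once. *)
  rewrite -subr_le0 -ler_expR expR0; apply: le_trans (ltW pot1).
  rewrite /potential (bigD1 v vU) /= (bigD1 w wU) /= -!addrA lerDl.
  rewrite !addr_ge0 ?mulr_ge0 ?invr_ge0 ?sqr_ge0 //.
    by apply: sumr_ge0 => u _; exact: expR_ge0.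
  by apply: sumr_ge0 => u _; apply: sumr_ge0 => u' _; exact: expR_ge0.
have degT v : deg (edges_within H [set: V]%SET) v = D by rewrite edges_withinT /deg HD.
have IT : edge_bound #|[set: V]%SET|%:R <= #|edges_within H [set: V]%SET|%:R.
  have rH : r%:R * #|H|%:R = N%:R * D%:R :> R.
    rewrite -!natrM -(@sum_deg_uniform _ _ _ Hr [set: V]%SET) => [|E _].
      under eq_bigr do rewrite /deg HD.
      by rewrite sum_nat_const cardsT.
    exact: finset.subsetT.
  have rN : r%:R ^+ 2 <= N%:R :> R.
    have : 1 + l <= N%:R by rewrite -[N%:R]lnK ?posrE // expR_ge1Dx.
    have : r%:R ^+ 2 <= r%:R ^+ 6 :> R by rewrite ler_weXn2l //; move: r2; lra.
    have : 0 <= r%:R ^+ 6 :> R by rewrite exprn_ge0.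
    move: l_ge; lra.
  have r0 : 0 < r%:R :> R by move: r2; lra.
  rewrite edges_withinT cardsT -(ler_pM2l r0) rH.
  apply: (@le_trans _ _ (r%:R * (D%:R / (r%:R * N%:R ^+ r.-1) * N%:R ^+ r))).
    apply: ler_wpM2l; first exact: ltW.
    apply: (@le_trans _ _ (D%:R / (r%:R * N%:R ^+ r.-1) * (N%:R - r%:R ^+ 2) ^+ r)).
      by rewrite lerBlDr lerDl mulr_ge0.
    apply: ler_wpM2l; first by rewrite divr_ge0 ?mulr_ge0 ?exprn_ge0.
    by apply: lerXn2r; rewrite ?nnegrE ?subr_ge0 // lerBlDr lerDl sqr_ge0.
  have -> : N%:R ^+ r = N%:R * N%:R ^+ r.-1 :> R by rewrite -exprS prednK // ltnW.
  rewrite le_eqVlt; apply/orP; left; apply/eqP; field.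
  by rewrite expf_neq0 gt_eqF.
(* Initially all gaps vanish: [N ^ 2] pairs weigh [expR (- (3 * l)) = N ^- 3] each, and the reserve
   is [N * eta = N ^- 1]. *)
have -> : 2 / N%:R = potential H lam eta g [set: V]%SET.
  have gN : g N = 3 * l by rewrite /g subrr mulr0 addr0.
  rewrite /potential cardsT -/N gN.
  under eq_bigr do under eq_bigr do
    rewrite /degree_gap !degT subrr mulr0 sub0r expRN expRM_natl lnK ?posrE //.
  rewrite !sumr_const cardsT -/N -mulrnA -[X in X + _]mulr_natl natrM /eta; field.
  by rewrite gt_eqF.
apply: le_trans (sum_run_prob_le_potential Hne step (n := N) _ IT); last first.
  by rewrite max_card.
rewrite edges_withinT /greedy_pr /unsaturated le_eqVlt; apply/orP; left; apply/eqP.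
apply: eq_bigl => s; rewrite finset.setTD ltr_pdivlMr //; by rewrite mulrC.
Qed.

End Finitary.

(** * Passage to the limit *)

Lemma greedy_prC (R : realType) (V : finType) (H : {set {set V}}) (P : pred {set {set V}}) :
  (forall E, E \in H -> E != finset.set0) ->
  greedy_pr R H P = 1 - greedy_pr R H (fun M => ~~ P M).
Proof.
move=> H0; rewrite -(greedy_prT R H0) /greedy_pr.
by rewrite [in RHS](bigID (fun s : _.-bseq _ => P [set E in s]%SET)) /= addrK.
Qed.

Local Open Scope classical_set_scope.
Local Open Scope ring_scope.

Theorem theorem1p1 (R : realType) (r : nat) (V : nat -> finType)
    (H : forall k : nat, {set {set V k}}) (D : nat -> nat) (h : nat -> R)
    (r_ge2 : (2 <= r)%N)
    (Huniform : forall k : nat, uniform r (H k))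
    (Hregular : forall k : nat, regular (D k) (H k))
    (N_infty : (fun k : nat => #|V k|) @ \oo --> \oo)
    (D_infty : D @ \oo --> \oo)
    (h_infty : h @ \oo --> +oo)
    (L_small : \forall k \near \oo,
      (max_pair_degree (H k))%:R = (D k)%:R / (ln (#|V k|%:R : R)) `^ (h k)) :
  exists eps : nat -> R,
    eps @ \oo --> (0 : R) /\
    (fun k : nat => greedy_pr R (H k) (fun M : {set {set V k}} =>
       unsaturated R M <=
         ((max_pair_degree (H k))%:R / (D k)%:R)
           `^ (1 / (2 * (r%:R - 1)) + eps k))) @ \oo --> (1 : R).
Proof.
exists (fun k => - (5 / h k)); split.
  rewrite -[X in _ --> X]oppr0; apply: cvgN; rewrite -[X in _ --> X](mulr0 5).
  apply: cvgM; first exact: cvg_cst.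
  by apply/gtr0_cvgV0 => //; apply: (cvgryPgt _).1 h_infty 0.
have NR : (fun k => #|V k|%:R : R) @ \oo --> +oo.
  exact: (cvg_comp _ _ N_infty cvgr_idn).
have low : \forall k \near \oo, 1 - 2 / #|V k|%:R <= greedy_pr R (H k) (fun M =>
       unsaturated R M <= ((max_pair_degree (H k))%:R / (D k)%:R)
           `^ (1 / (2 * (r%:R - 1)) + - (5 / h k))) <= 1.
  near=> k.
  have Dk : (0 < D k)%N by near: k; apply: (cvgnyPgt _).1 D_infty 0%N.
  have Nk : expR (544 * r%:R ^+ 6) <= #|V k|%:R :> R.
    by near: k; apply: (cvgryPge _).1 NR _.
  have lk : 544 * r%:R ^+ 6 <= ln (#|V k|%:R : R).
    by rewrite -ler_expR lnK // posrE; apply: lt_le_trans Nk; exact: expR_gt0.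
  have hk : 0 < h k by near: k; apply: (cvgryPgt _).1 h_infty _.
  have Lk : (max_pair_degree (H k))%:R = (D k)%:R / (ln (#|V k|%:R : R)) `^ (h k).
    by near: k.
  have Hne E : E \in H k -> E != finset.set0.
    by move=> /Huniform EH; rewrite -card_gt0 EH ltnW.
  have l0 : 0 < ln (#|V k|%:R : R).
    by apply: lt_le_trans lk; rewrite mulr_gt0 ?exprn_gt0 ?ltr0n // ltnW.
  have LD : (max_pair_degree (H k))%:R / (D k)%:R = ln (#|V k|%:R : R) `^ (- h k).
    by rewrite Lk powRN mulrAC divff ?mul1r // pnatr_eq0 -lt0n.
  (* As [L / D] is [ln N] to the power [- h k], the correction [- (5 / h k)] contributes exactly the
     factor [ln N ^+ 5] of the finite threshold. *)
  have -> : ((max_pair_degree (H k))%:R / (D k)%:R) `^ (1 / (2 * (r%:R - 1)) + - (5 / h k))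
    = ((max_pair_degree (H k))%:R / (D k)%:R) `^ (1 / (2 * (r%:R - 1))) * ln (#|V k|%:R : R) ^+ 5.
    rewrite powRD; last by apply/implyP => _; rewrite LD gt_eqF ?powR_gt0.
    congr (_ * _); rewrite LD -powRrM mulrNN mulrCA divff ?gt_eqF // mulr1.
    by rewrite powR_mulrn // ltW.
  apply/andP; split; last first.
    rewrite (greedy_prC R _ Hne) lerBlDr lerDl.
    by apply: sumr_ge0 => s _; exact: run_prob_ge0.
  rewrite (greedy_prC R _ Hne) lerD2l lerN2.
  apply: le_trans (greedy_pr_unsaturated_gt r_ge2 (@Huniform k) (@Hregular k) Dk lk).
  rewrite /greedy_pr le_eqVlt; apply/orP; left; apply/eqP.
  by apply: eq_bigl => s; rewrite -ltNge.
apply: (@squeeze_cvgr _ _ _ _ (fun k => 1 - 2 / #|V k|%:R) (fun=> 1) _ low).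
- rewrite -[X in _ --> X](subr0 1) -[X in _ - X](mulr0 2).
  apply: cvgB; first exact: cvg_cst.
  apply: cvgM; first exact: cvg_cst.
  by apply/gtr0_cvgV0 => //; apply: (cvgryPgt _).1 NR 0.
- exact: cvg_cst.
Unshelve. all: end_near.
Qed.
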